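(* Let $d$ be a positive integer and let $F:\mathbb{R}^d\to\mathbb{R}$ be a continuous function which is nondegenerate and noncompact. Let $x\in X_d$ be a lattice whose $H_F$-orbit $H_Fx$ is nondivergent (i.e. not divergent), and let $\lambda$ be the Lebesgue (Haar) probability measure of the full torus $\pi^{-1}(x)\cong\mathbb{R}^d/x$. Then $x$ is $\lambda$-almost surely grid-DV, i.e. $\lambda$-almost every grid $y\in\pi^{-1}(x)$ is DV.
   Context: Let $G=\mathrm{SL}_d(\mathbb{R})$, $\Gamma=\mathrm{SL}_d(\mathbb{Z})$. $X_d=G/\Gamma$ (quotient topology) is identified with the space of unimodular (covolume 1) lattices in $\mathbb{R}^d$ via $g\Gamma\mapsto g\mathbb{Z}^d$. $Y_d=(G\ltimes\mathbb{R}^d)/(\Gamma\ltimes\mathbb{Z}^d)$ (quotient topology) is identified with the space of unimodular grids, i.e. translated lattices $x+v=\{w+v:w\in x\}$ with $x\in X_d$, $v\in\mathbb{R}^d$. $\pi:Y_d\to X_d$ is $\pi(x+v)=x$; the fiber $\pi^{-1}(x)$ is identified with the torus $\mathbb{R}^d/x$. $G$ acts on $X_d$ and $Y_d$ by the linear action on subsets of $\mathbb{R}^d$. For a continuous $F:\mathbb{R}^d\to\mathbb{R}$ and $y\in Y_d$, the value set is $V_F(y)=\{F(v):v\in y\}$. A grid $y$ is DV (dense values) if $V_F(y)$ is dense in $F(\mathbb{R}^d)$. For a probability measure $\mu$ on $\pi^{-1}(x)$, the lattice $x$ is $\mu$-almost surely grid-DV if $\mu$-almost every $y\in\pi^{-1}(x)$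 is DV. The invariance group $H_F$ is the connected component of the identity in $\{g\in G:F\circ g=F\}$. $F$ is noncompact if $H_F$ is noncompact. $F$ is nondegenerate if for every subspace $\{0\}\ne U<\mathbb{R}^d$ and every grid $y\in Y_d$ one has $\{F(u+v):u\in U,\ v\in y\}=F(\mathbb{R}^d)$. A sequence in a topological space is divergent if it has no converging subsequence. An orbit $H_Fx$ is divergent if for every divergent sequence $h_n\in H_F$ the sequence $h_nx$ is divergent in $X_d$. *)

(* Defs.v *)
From HB Require Import structures.
From mathcomp Require Import all_boot all_order all_algebra.
From mathcomp Require Import all_classical all_reals all_analysis.

Set Implicit Arguments.
Unset Strict Implicit.
Unset Printing Implicit Defensive.

Import Order.TTheory GRing.Theory Num.Theory.
Import numFieldNormedType.Exports.

Local Open Scope classical_set_scope.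
Local Open Scope ring_scope.

Section GroupsLatticesGrids.
Context {R : realType} {d : nat}.

(* Used as a type through the coercion set_type, this carries the subspace
   topology of the space of matrices. *)
Definition SL : set 'M[R]_d := [set g | \det g = 1].

Lemma SL_one_subproof : (1%:M : 'M[R]_d) \in SL.
Proof. by apply/mem_set; rewrite /SL /= det1. Qed.

Definition SL_one : SL := exist _ 1%:M SL_one_subproof.

Definition Zspan (g : 'M[R]_d) : set 'cV[R]_d :=
  [set g *m map_mx intr z | z in [set: 'cV[int]_d]].

Definition translate_set (A : set 'cV[R]_d) (v : 'cV[R]_d) : set 'cV[R]_d :=
  [set w + v | w in A].

Record lattice := Lattice {
  lattice_set :> set 'cV[R]_d;
  latticeP : exists g : SL, lattice_set = Zspan (val g) }.

Record grid := Grid {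
  grid_set :> set 'cV[R]_d;
  gridP : exists (x : lattice) (v : 'cV[R]_d), grid_set = translate_set x v }.

End GroupsLatticesGrids.

Arguments SL : clear implicits.
Arguments lattice : clear implicits.
Arguments grid : clear implicits.

Section Quotients.
Context {R : realType} {d : nat}.

Lemma lattice_inj (x x' : lattice R d) : x = x' :> set 'cV[R]_d -> x = x'.
Proof.
case: x x' => [A pA] [B pB] /= AB; rewrite AB in pA *.
by congr Lattice; exact: Prop_irrelevance.
Qed.

Lemma grid_inj (y y' : grid R d) : y = y' :> set 'cV[R]_d -> y = y'.
Proof.
case: y y' => [A pA] [B pB] /= AB; rewrite AB in pA *.
by congr Grid; exact: Prop_irrelevance.
Qed.

Definition lattice_of (g : SL R d) : lattice R d :=
  Lattice (ex_intro _ g erefl).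

Definition translate (x : lattice R d) (v : 'cV[R]_d) : grid R d :=
  Grid (ex_intro _ x (ex_intro _ v erefl)).

(* gZ^d + v is the image of Z^d under the affine map w |-> g w + v, so this is
   the orbit map of the affine group at the standard lattice *)
Definition grid_of (gv : SL R d * 'cV[R]_d) : grid R d :=
  translate (lattice_of gv.1) gv.2.

Definition lattice_repr (x : lattice R d) : SL R d := sval (cid (latticeP x)).

Lemma lattice_reprK : cancel lattice_repr lattice_of.
Proof.
move=> x; apply: lattice_inj => /=; rewrite /lattice_repr.
by case: (cid _) => g /= ->.
Qed.

Definition grid_repr (y : grid R d) : SL R d * 'cV[R]_d :=
  let: exist x xP := cid (gridP y) in (lattice_repr x, sval (cid xP)).

Lemma grid_reprK : cancel grid_repr grid_of.
Proof.
move=> y; apply: grid_inj; rewrite /grid_repr; case: (cid (gridP y)) => x xP.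
by case: (cid xP) => v /= ->; rewrite -{2}(lattice_reprK x).
Qed.

(* The fibres of lattice_of and grid_of are the left cosets of SL_d(Z) in
   SL_d(R) and of the integral affine group in the real one, so the topologies
   below are those of the homogeneous spaces. *)
HB.instance Definition _ :=
  @isQuotient.Build (SL R d) (lattice R d)
    lattice_repr lattice_of lattice_reprK.
HB.instance Definition _ :=
  Topological.copy (lattice R d) (quotient_topology (lattice R d)).

HB.instance Definition _ :=
  @isQuotient.Build (SL R d * 'cV[R]_d)%type (grid R d)
    grid_repr grid_of grid_reprK.
HB.instance Definition _ :=
  Topological.copy (grid R d) (quotient_topology (grid R d)).

Lemma open_latticeE (U : set (lattice R d)) : open U = open (lattice_of @^-1` U).
Proof. by rewrite {1}/open /= /quotient_open unlock. Qed.

Lemma open_gridE (U : set (grid R d)) : open U = open (grid_of @^-1` U).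
Proof. by rewrite {1}/open /= /quotient_open unlock. Qed.

Lemma act_subproof (g : SL R d) (x : lattice R d) :
  exists g' : SL R d,
    [set val g *m w | w in (x : set 'cV[R]_d)] = Zspan (val g').
Proof.
case: x => A [h /= ->]; have gh : val g *m val h \in SL R d.
  by apply/mem_set; rewrite /SL /= det_mulmx (set_valP g) (set_valP h) mulr1.
exists (exist (fun M => M \in SL R d) _ gh); apply/seteqP; split=> w /=.
  by move=> [_ [z _ <-] <-]; exists z; rewrite // mulmxA.
move=> [z _ <-]; exists (val h *m map_mx intr z); last by rewrite mulmxA.
by exists z.
Qed.

Definition act (g : SL R d) (x : lattice R d) : lattice R d :=
  Lattice (act_subproof g x).

Lemma translate_diff (x : lattice R d) (v : 'cV[R]_d) :
  [set p - q | p in translate_set x v & q in translate_set x v] =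
  x :> set 'cV[R]_d.
Proof.
case: x => A [g /= ->]; apply/seteqP; split=> w /=.
  move=> [_ [_ [z _ <-] <-] [_ [_ [t _ <-] <-] <-]].
  exists (z - t) => //; rewrite map_mxB mulmxBr.
  by rewrite opprD addrACA subrr addr0.
move=> [z _ <-]; exists (val g *m map_mx intr z + v).
  by exists (val g *m map_mx intr z) => //; exists z.
exists v; last by rewrite addrK.
exists 0; last by rewrite add0r.
by exists 0; rewrite // map_mx0 mulmx0.
Qed.

Lemma grid_proj_subproof (y : grid R d) : exists g : SL R d,
  [set p - q | p in (y : set 'cV[R]_d) & q in (y : set 'cV[R]_d)] =
  Zspan (val g).
Proof.
case: y => A [x [v /= ->]]; rewrite translate_diff; exact: latticeP.
Qed.

(* the lattice underlying y is the set of differences of points of y *)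
Definition grid_proj (y : grid R d) : lattice R d :=
  Lattice (grid_proj_subproof y).

Lemma grid_proj_translate (x : lattice R d) (v : 'cV[R]_d) :
  grid_proj (translate x v) = x.
Proof. by apply: lattice_inj; exact: translate_diff. Qed.

Definition fiber (x : lattice R d) : Type :=
  set_type (grid_proj @^-1` [set x]).

HB.instance Definition _ (x : lattice R d) :=
  Topological.copy (fiber x) (set_type (grid_proj @^-1` [set x])).

Definition fiber_grid (x : lattice R d) (y : fiber x) : grid R d := val y.

Lemma fiber_translate_subproof (x : lattice R d) (v : 'cV[R]_d) :
  translate x v \in grid_proj @^-1` [set x].
Proof. by apply/mem_set; exact: grid_proj_translate. Qed.

Definition fiber_translate (x : lattice R d) (v : 'cV[R]_d) : fiber x :=
  exist _ (translate x v) (fiber_translate_subproof x v).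

Lemma torus_act_subproof (x : lattice R d) (v : 'cV[R]_d) (y : fiber x) :
  exists w, translate_set (fiber_grid y) v = translate x w.
Proof.
case: (gridP (val y)) => x' [w yE]; exists (w + v).
have xE : x = x' :> set 'cV[R]_d.
  have /= <- := congr1 lattice_set (set_valP y).
  by rewrite yE translate_diff.
rewrite /fiber_grid /= yE xE; apply/seteqP; split=> u /=.
  by move=> [_ [t xt <-] <-]; exists t; rewrite // addrA.
by move=> [t xt <-]; exists (t + w); [exists t|rewrite addrA].
Qed.

(* the action of R^d on the torus R^d / x by translations *)
Definition torus_act (x : lattice R d) (v : 'cV[R]_d) (y : fiber x) : fiber x :=
  fiber_translate x (sval (cid (torus_act_subproof v y))).

Lemma torus_actE (x : lattice R d) (v : 'cV[R]_d) (y : fiber x) :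
  fiber_grid (torus_act v y) = translate_set (fiber_grid y) v :> set 'cV[R]_d.
Proof. by rewrite /torus_act /=; case: (cid _) => w /= ->. Qed.

HB.instance Definition _ (x : lattice R d) :=
  isPointed.Build (fiber x) (fiber_translate x 0).

Definition borel_fiber (x : lattice R d) :=
  g_sigma_algebraType (@open (fiber x)).

(* The Lebesgue probability measure of the torus is its unique
   translation-invariant Borel probability measure. *)
Definition is_haar (x : lattice R d) (lambda : probability (borel_fiber x) R) :=
  forall (v : 'cV[R]_d) (A : set (borel_fiber x)), measurable A ->
    lambda (torus_act v @^-1` A) = lambda A.

Definition value_set (F : 'cV[R]_d -> R) (y : grid R d) : set R :=
  F @` (y : set 'cV[R]_d).

Definition DV (F : 'cV[R]_d -> R) (y : grid R d) :=
  range F `<=` closure (value_set F y).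

Definition almost_surely_grid_DV (F : 'cV[R]_d -> R) (x : lattice R d)
    (mu : probability (borel_fiber x) R) :=
  {ae mu, forall y, DV F (fiber_grid y)}.

Definition stabilizer (F : 'cV[R]_d -> R) : set (SL R d) :=
  [set g | forall v, F (val g *m v) = F v].

Definition invariance_group (F : 'cV[R]_d -> R) : set (SL R d) :=
  connected_component (stabilizer F) SL_one.

Definition noncompact_fun (F : 'cV[R]_d -> R) := ~ compact (invariance_group F).

Definition nondegenerate_fun (F : 'cV[R]_d -> R) :=
  forall (U : {vspace 'cV[R]_d}) (y : grid R d), U != 0%VS ->
    [set F (u + v) | u in [set` U] & v in (y : set 'cV[R]_d)] = range F.

Definition divergent_seq {T : topologicalType} (u : nat -> T) :=
  ~ exists (phi : nat -> nat) (l : T),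
      {homo phi : m n / (m < n)%N} /\ u \o phi @ \oo --> l.

Definition divergent_orbit (F : 'cV[R]_d -> R) (x : lattice R d) :=
  forall h : nat -> set_type (invariance_group F), divergent_seq h ->
    divergent_seq (fun n => act (val (h n)) x).

End Quotients.

(* Main.v *)
(* Nondivergence gives A_n in H_F with A_n x converging to some gZ^d and
   |A_n| -> oo, hence vectors e_n -> 0 with A_n e_n converging to some u != 0.
   Fix an open O meeting the range of F and let E be the set of grids y over x
   on which F misses O; E is closed.  Translations by t e_n tend to the identity
   and preserve the Haar measure, so the measure of the set of y in E with
   y + t e_n outside E tends to 0.  On the other hand A_n y is a grid over a
   lattice close to gZ^d, and by nondegeneracy every grid over gZ^d acquires a
   point of F^-1(O) after a translation by some multiple of u.  By compactness
   finitely many rational multiples t suffice, so for n large, every y in E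
   satisfies A_n y + t A_n e_n = A_n (y + t e_n), F o A_n = F, and therefore
   y + t e_n lies outside E, for one of these t.  Hence E is null. *)

Require Import Defs.
From HB Require Import structures.
From mathcomp Require Import all_boot all_order all_algebra.
From mathcomp Require Import perm.
From mathcomp Require Import all_classical all_reals all_analysis.

Set Implicit Arguments.
Unset Strict Implicit.
Unset Printing Implicit Defensive.

Import numFieldNormedType.Exports.

Import Order.TTheory GRing.Theory Num.Def Num.Theory.

Local Open Scope classical_set_scope.
Local Open Scope ring_scope.

(** * Continuity, norm bounds and compactness for real matrices *)

Section MatrixAnalysis.
Context {R : realType}.

Lemma cvg_mx {I : Type} {m n : nat} (F : set_system I) {FF : Filter F}
    (u : I -> 'M[R]_(m, n)) (l : 'M[R]_(m, n)) :
  (forall i j, u k i j @[k --> F] --> l i j) -> u @ F --> l.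
Proof.
move=> ul A [P lP PA].
suff : \forall k \near F, forall i j, P i j (u k i j).
  by apply: filterS => k; exact: PA.
by apply: filter_forall => i; apply: filter_forall => j; exact: ul.
Qed.

Lemma mulmx_continuous (m n p : nat) :
  continuous (fun AB : 'M[R]_(m, n) * 'M[R]_(n, p) => AB.1 *m AB.2).
Proof.
move=> [A B]; apply: cvg_mx => i j /=; rewrite mxE.
under eq_cvg do rewrite mxE.
apply: cvg_big; first exact: add_continuous.
move=> k _; apply: cvgM.
  apply: (@cvg_comp _ _ _ fst (fun M : 'M[R]_(m, n) => M i k) _ (nbhs A)).
    exact: cvg_fst.
  exact: coord_continuous.
apply: (@cvg_comp _ _ _ snd (fun M : 'M[R]_(n, p) => M k j) _ (nbhs B)).
  exact: cvg_snd.
exact: coord_continuous.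
Qed.

Lemma cvg_mulmx {I : Type} {m n p : nat} (F : set_system I) {FF : Filter F}
    (A : I -> 'M[R]_(m, n)) (B : I -> 'M[R]_(n, p)) (a : 'M[R]_(m, n))
    (b : 'M[R]_(n, p)) :
  A @ F --> a -> B @ F --> b -> A k *m B k @[k --> F] --> a *m b.
Proof.
by apply: continuous2_cvg; exact: (@mulmx_continuous _ _ _ (a, b)).
Qed.

Lemma det_continuous (n : nat) : continuous (fun A : 'M[R]_n => \det A).
Proof.
have H (s : 'S_n) : continuous (fun A : 'M[R]_n => \prod_i A i (s i)).
  apply: continuous_big; first exact: mul_continuous.
  by move=> i _; exact: coord_continuous.
apply: continuous_big; first exact: add_continuous.
move=> s _ A; apply: (@cvgM _ _ _ (nbhs_filter A)); first exact: cvg_cst.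
exact: H.
Qed.

Lemma coord_le_norm (m n : nat) (A : 'M[R]_(m, n)) i j : `|A i j| <= `|A|.
Proof.
rewrite [leRHS]/normr /= mx_normrE.
exact: (le_bigmax _ (fun ij => `|A ij.1 ij.2|) (i, j)).
Qed.

Lemma norm_le_coord (m n : nat) (A : 'M[R]_(m, n)) (c : R) :
  0 <= c -> (forall i j, `|A i j| <= c) -> `|A| <= c.
Proof.
move=> c0 Ac; rewrite [leLHS]/normr /= mx_normrE.
by apply: bigmax_le => // -[i j] _; exact: Ac.
Qed.

(** The norm is the largest absolute value of an entry, and an entry of the product is a sum of [n]
    products; hence the factor [n%:R]. *)
Lemma ler_norm_mulmx (m n p : nat) (A : 'M[R]_(m, n)) (B : 'M[R]_(n, p)) :
  `|A *m B| <= n%:R * (`|A| * `|B|).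
Proof.
apply: norm_le_coord => [|i j]; first by rewrite !mulr_ge0.
rewrite mxE (le_trans (ler_norm_sum _ _ _))//.
have -> : n%:R * (`|A| * `|B|) = \sum_(k < n) `|A| * `|B|.
  by rewrite sumr_const card_ord mulr_natl.
by apply: ler_sum => k _; rewrite normrM ler_pM// coord_le_norm.
Qed.

Lemma compact_closed_ball_cV (n : nat) (r : R) :
  compact [set v : 'cV[R]_n | `|v| <= r].
Proof.
(* Heine-Borel is applied to row vectors and carried over by transposition, which preserves the norm
   and is continuous. *)
have -> : [set v : 'cV[R]_n | `|v| <= r] =
    trmx @` [set v : 'rV[R]_n | `|v| <= r].
  have H (p q : nat) (v : 'M[R]_(p, q)) : `|v^T| <= `|v|.
    by apply: norm_le_coord => // i j; rewrite mxE coord_le_norm.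
  apply/seteqP; split => [v /= vr|_ [v /= vr <-]].
    by exists v^T; rewrite ?trmxK//=; exact: le_trans (H _ _ _) vr.
  exact: le_trans (H _ _ _) vr.
apply: continuous_compact.
  apply: continuous_subspaceT => v.
  apply: (@cvg_mx _ _ _ _ (nbhs_filter v)) => i j.
  under eq_cvg do rewrite mxE.
  by rewrite mxE; exact: coord_continuous.
apply: bounded_closed_compact.
  exists r; split; rewrite ?num_real// => s rs v /= vr.
  exact: le_trans vr (ltW rs).
rewrite (_ : mkset _ = (fun v => `|v|) @^-1` [set x : R | x <= r])//.
by apply: closed_comp; [move=> v _; exact: norm_continuous|exact: closed_le].
Qed.

End MatrixAnalysis.

(** * Convergent subsequences of bounded sequences *)

Lemma homo_ltn_cvgy (f : nat -> nat) :
  {homo f : m n / (m < n)%N} -> f @ \oo --> \oo.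
Proof.
move=> fi A [N _ NA]; exists N => // n /= Nn; apply: NA => /=.
apply: leq_trans Nn _; elim: n => // n IHn.
by apply: leq_ltn_trans IHn _; exact: fi.
Qed.

Section Subsequences.
Context {R : realType}.

Lemma bounded_cvg_subsequence (u : nat -> R) (c : R) :
  (forall n, `|u n| <= c) ->
  exists2 f : nat -> nat, {homo f : m n / (m < n)%N} & cvgn (u \o f).
Proof.
move=> uc; have [|f fi fc] := @bolzano_weierstrass _ u.
  exists c; split; rewrite ?num_real// => s cs n _.
    exact: le_trans (uc n) (ltW cs).
exists f => // m n mn.
by have := leW_mono fi m n; rewrite !ltEnat /= mn => ->.
Qed.

Lemma bounded_mx_cvg_subsequence (m n : nat) (u : nat -> 'M[R]_(m, n)) (c : R) :
  (forall k, `|u k| <= c) ->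
  exists (f : nat -> nat) (l : 'M[R]_(m, n)),
    {homo f : p q / (p < q)%N} /\ u \o f @ \oo --> l.
Proof.
move=> uc.
(* Bolzano-Weierstrass is applied to one entry at a time; the entries treated earlier still converge
   along the refined subsequence. *)
have H (s : seq ('I_m * 'I_n)) : exists2 f : nat -> nat,
    {homo f : p q / (p < q)%N} &
    forall ij, ij \in s -> cvgn (fun k => u (f k) ij.1 ij.2).
  elim: s => [|[i j] s [f fi fs]]; first by exists id.
  have [|g gi gc] := @bounded_cvg_subsequence (fun k => u (f k) i j) c.
    by move=> k; exact: le_trans (coord_le_norm _ _ _) (uc _).
  exists (f \o g) => [p q pq|[i' j']]; first exact/fi/gi.
  rewrite inE => /predU1P[[-> ->]//|/fs/= /cvg_ex[l cl]].
  apply/cvg_ex; exists l.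
  apply: (@cvg_comp _ _ _ g (fun k => u (f k) i' j') _ \oo _ _ cl).
  exact: homo_ltn_cvgy.
have [f fi fs] := H (enum [set: 'I_m * 'I_n]).
exists f, (\matrix_(i, j) lim ((fun k => u (f k) i j) @ \oo)); split=> //.
apply: cvg_mx => i j; rewrite mxE.
by apply: (fs (i, j)); rewrite mem_enum inE.
Qed.

End Subsequences.

(** * Escape to infinity in the invariance group, and convergence of lattices *)

Section Groups.
Context {R : realType} {d : nat}.

Lemma cvg_set_type {T : topologicalType} (A : set T) {I : Type}
    (F : set_system I) {FF : Filter F} (u : I -> A) (l : A) :
  (fun k => val (u k)) @ F --> val l -> u @ F --> l.
Proof.
move=> ul U [_ [[W oW <-]] /= Wl] /filterS; apply; apply: ul.
exact: open_nbhs_nbhs.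
Qed.

Lemma closed_SL : closed (SL R d).
Proof.
apply: (@closed_comp _ _ (fun g : 'M[R]_d => \det g) [set 1]).
  by move=> g _; exact: det_continuous.
exact: closed_eq.
Qed.

Lemma SL_val_continuous : continuous (fun g : SL R d => val g).
Proof. exact: initial_continuous. Qed.

Lemma SL_mulmx_continuous (n : nat) (A : 'M[R]_(d, n)) :
  continuous (fun g : SL R d => val g *m A).
Proof.
move=> g; apply: (@cvg_mulmx _ _ _ _ _ _ (nbhs_filter g)).
  exact: SL_val_continuous.
exact: cvg_cst.
Qed.

(** The stabilizer is an intersection of closed conditions, one for each vector, and a component of
    a closed set is closed. *)
Lemma closed_invariance_group (F : 'cV[R]_d -> R) :
  continuous F -> closed (invariance_group F).
Proof.
move=> Fc; apply: component_closed.
have -> : stabilizer F =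
    \bigcap_v [set g : SL R d | F (val g *m v) = F v].
  by apply/seteqP; split => g /= gF v; [move=> _|]; exact: gF.
apply: closed_bigI => v _.
apply: (@closed_comp _ _ (fun g : SL R d => F (val g *m v)) [set F v]);
  last exact: closed_eq.
move=> g _; apply: continuous_comp; last exact: Fc.
exact: SL_mulmx_continuous.
Qed.

Lemma not_near_subsequence (P : nat -> Prop) :
  ~ (\forall n \near \oo, P n) ->
  exists2 f : nat -> nat, {homo f : m n / (m < n)%N} & forall n, ~ P (f n).
Proof.
move=> nP; have H n : exists m, (n <= m)%N /\ ~ P m.
  apply: contrapT => nH; apply: nP; exists n => // m /= nm.
  by apply: contrapT => nPm; apply: nH; exists m.
have [f fP] := choice H.
pose g := fix g n := if n is m.+1 then f (g m).+1 else f 0.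
have gS n : (g n < g n.+1)%N by have [] := fP (g n).+1.
exists g; first exact: (homo_ltn ltn_trans).
by case=> [|n]; [have [] := fP 0|have [] := fP (g n).+1].
Qed.

(** Otherwise infinitely many terms have norm at most [c], and a subsequence of them converges as
    matrices. Its limit stays in [SL] and in the invariance group because both are closed, which
    contradicts divergence. *)
Lemma divergent_invariance_group_norm (F : 'cV[R]_d -> R)
    (h : nat -> set_type (invariance_group F)) (c : R) :
  continuous F -> divergent_seq h ->
  \forall n \near \oo, c < `|val (val (h n)) : 'M[R]_d|.
Proof.
move=> Fc hdiv; apply: contrapT => /not_near_subsequence[f fi fc].
have [|g [l [gi gl]]] :=
    @bounded_mx_cvg_subsequence _ _ _ (fun n => val (val (h (f n)))) c.
  by move=> n; rewrite leNgt; apply/negP/fc.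
have lSL : l \in SL R d.
  apply/mem_set; apply: (closed_cvg _ closed_SL _ _ gl).
  by apply: nearW => n; exact: set_valP.
pose l' : SL R d := exist _ l lSL.
have hl' : (fun n => val (h (f (g n)))) @ \oo --> l'.
  exact: cvg_set_type.
have l'F : l' \in invariance_group F.
  apply/mem_set.
  apply: (closed_cvg _ (closed_invariance_group Fc) _ _ hl').
  by apply: nearW => n; exact: set_valP.
apply: hdiv; exists (f \o g), (exist _ l' l'F); split.
  by move=> p q pq; exact/fi/gi.
exact: cvg_set_type.
Qed.

Lemma Zspan_basis (g B : 'M[R]_d) :
  (forall z : 'cV[int]_d, Zspan g (B *m map_mx intr z)) <->
  exists Z : 'M[int]_d, B = g *m map_mx intr Z.
Proof.
split=> [gB|[Z ->] z]; last by exists (Z *m z); rewrite // map_mxM mulmxA.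
have H j : exists z : 'cV[int]_d, g *m map_mx intr z = col j B.
  have [z _ zE] := gB (delta_mx j 0); exists z.
  by rewrite zE map_delta_mx -colE.
have [z zE] := choice H.
exists (\matrix_(i, j) z j i 0); apply/matrixP => i j.
have := congr1 (fun M : 'cV[R]_d => M i 0) (zE j); rewrite !mxE => <-.
by apply: eq_bigr => k _; rewrite !mxE.
Qed.

(** This replaces a lift of the convergence to matrices. The lattices containing [B Z^d] for some
    [B] in the interior of [V] form an open set: by [Zspan_basis] its preimage in the group is the
    union, over integer matrices [Z], of the open conditions that [g' Z] lies in this interior.
    [B Z^d] may be a proper sublattice; only the supply of lattice points matters. *)
Lemma near_lattice_basis {I : Type} (F : set_system I) {FF : Filter F}
    (u : I -> lattice R d) (g : SL R d) (V : set 'M[R]_d) :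
  u @ F --> lattice_of g -> nbhs (val g) V ->
  \forall k \near F, exists2 B, V B &
    forall z : 'cV[int]_d, (u k : set 'cV[R]_d) (B *m map_mx intr z).
Proof.
move=> ug gV.
pose O : set (lattice R d) := [set x | exists2 B, interior V B &
    forall z : 'cV[int]_d, (x : set 'cV[R]_d) (B *m map_mx intr z)].
have oO : open O.
  rewrite open_latticeE.
  have -> : lattice_of @^-1` O = \bigcup_(Z in [set: 'M[int]_d])
      ((fun g : SL R d => val g *m map_mx intr Z) @^-1` interior V).
    apply/seteqP; split=> g' /=.
      by move=> [B VB /Zspan_basis[Z BE]]; exists Z => //; move: VB; rewrite BE.
    by move=> [Z _ VZ]; exists (val g' *m map_mx intr Z) => //;
       apply/Zspan_basis; exists Z.
  apply: bigcup_open => Z _; apply: open_comp; last exact: open_interior.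
  by move=> g' _; exact: SL_mulmx_continuous.
have uO : \forall k \near F, O (u k).
  apply: ug; apply: open_nbhs_nbhs; split=> //; exists (val g) => // z.
  by exists z.
by apply: filterS uO => k [B /interior_subset VB Bz]; exists B.
Qed.

End Groups.

(** * Sets of grids avoiding an open set, and their Haar measure *)

Section Haar.
Context {R : realType} {d : nat}.

Lemma open_grid_meets (O : set 'cV[R]_d) :
  open O -> open [set y : grid R d | exists2 p, (y : set 'cV[R]_d) p & O p].
Proof.
move=> oO; rewrite open_gridE.
rewrite (_ : _ @^-1` _ = \bigcup_(z in [set: 'cV[int]_d])
    ((fun gv : SL R d * 'cV[R]_d =>
        val gv.1 *m map_mx intr z + gv.2) @^-1` O)); last first.
  apply/seteqP; split=> -[g v] /=.
    by move=> [_ [_ [z _ <-] <-] Op]; exists z.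
  move=> [z _ Oz]; exists (val g *m map_mx intr z + v) => //.
  by exists (val g *m map_mx intr z) => //; exists z.
apply: bigcup_open => z _; apply: open_comp => // -[g v] _.
apply: cvgD; last exact: cvg_snd.
apply: (@continuous_comp _ _ _ fst (fun g : SL R d => val g *m map_mx intr z)).
  exact: cvg_fst.
exact: SL_mulmx_continuous.
Qed.

Variables (x : lattice R d).

Definition fiber_avoiding (O : set 'cV[R]_d) : set (borel_fiber x) :=
  [set y | forall p, (fiber_grid y : set 'cV[R]_d) p -> ~ O p].

Lemma measurable_fiber_avoiding (O : set 'cV[R]_d) :
  open O -> measurable (fiber_avoiding O).
Proof.
move=> oO; rewrite -(setCK (fiber_avoiding O)); apply: measurableC.
apply: sub_sigma_algebra.
exists [set y : grid R d | exists2 p, (y : set 'cV[R]_d) p & O p].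
  exact: open_grid_meets.
apply/seteqP; split=> y /=.
  by move=> [p yp Op] /(_ p yp).
move=> /existsNP[p /not_implyP[yp /contrapT Op]].
by exists p.
Qed.

(** Moving the grid by [w] amounts to moving [O] by [-w]. Measurability of translated avoidance sets
    thus follows without proving [torus_act] continuous. *)
Lemma torus_act_fiber_avoiding (O : set 'cV[R]_d) (w : 'cV[R]_d) :
  torus_act w @^-1` fiber_avoiding O = fiber_avoiding [set p | O (p + w)].
Proof.
apply/seteqP; split=> y yO p.
  by move=> yp; apply: (yO (p + w)); rewrite torus_actE; exists p.
by rewrite torus_actE => -[q yq <-]; exact: yO.
Qed.

Lemma open_translate (O : set 'cV[R]_d) (w : 'cV[R]_d) :
  open O -> open [set p | O (p + w)].
Proof.
move=> oO; apply: open_comp => // p _.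
by apply: (cvgD (FF := nbhs_filter p)); [exact: cvg_id|exact: cvg_cst].
Qed.

(* By invariance, E \ T_n^-1 E and T_n^-1 E \ E have the same measure, and the
   latter sets have empty limit superior because E is closed. *)
Lemma haar_shift_cvg (lambda : probability (borel_fiber x) R)
    (O : set 'cV[R]_d) (w : nat -> 'cV[R]_d) :
  is_haar lambda -> open O -> w @ \oo --> (0 : 'cV[R]_d) ->
  lambda (fiber_avoiding O `\` torus_act (w n) @^-1` fiber_avoiding O)
    @[n --> \oo] --> 0%E.
Proof.
move=> haar oO w0.
pose E : set (borel_fiber x) := fiber_avoiding O.
have mE : measurable E by exact: measurable_fiber_avoiding.
pose T n : set (borel_fiber x) := torus_act (w n) @^-1` E.
have TE n : T n = fiber_avoiding [set p | O (p + w n)].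
  exact: torus_act_fiber_avoiding.
have mT n : measurable (T n).
  by rewrite TE; apply: measurable_fiber_avoiding; exact: open_translate.
have lT n : lambda (T n) = lambda E by exact: haar.
pose D n := T n `\` E.
have mD n : measurable (D n) by exact: measurableD.
have fin A : measurable A -> (lambda A < +oo)%E.
  by move=> mA; rewrite (le_lt_trans (probability_le1 _ mA))// ltry.
have DE n : lambda (E `\` T n) = lambda (D n).
  rewrite /D (measureD mE (mT n) (fin _ mE)).
  rewrite (measureD (mT n) mE (fin _ (mT n))).
  by rewrite setIC; congr (_ - _)%E; exact: (esym (lT n)).
change (lambda (E `\` T n) @[n --> \oo] --> 0%E).
under eq_cvg do rewrite DE.
have mU := bigcup_measurable (fun k (_ : (k >= 0)%N) => mD k).
have H := lim_sup_set_cvg lambda D mD (fin _ mU).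
have D0 : lim_sup_set D = set0.
  rewrite -subset0 => y yD.
  have [_ _ [_ +]] := yD 0 I.
  move=> /existsNP[p /not_implyP[yp /contrapT Op]].
  have : \forall n \near \oo, O (p + w n).
    have : p + w n @[n --> \oo] --> p + 0 by apply: cvgD => //; exact: cvg_cst.
    by apply; rewrite addr0; exact: open_nbhs_nbhs.
  move=> [N _ NO]; have [n /= Nn [+ _]] := yD N I.
  rewrite TE => /(_ p yp); apply.
  exact: NO.
rewrite D0 measure0 in H.
apply: squeeze_cvge H; last exact: cvg_cst.
apply: nearW => n; rewrite measure_ge0/= le_measure ?inE//.
  by apply: bigcup_measurable.
by move=> y Dy; exists n => /=.
Qed.

End Haar.

Arguments fiber_avoiding {R d} x O _.

(** * Recurrence of the orbit and nullity of the avoidance sets *)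

Section NullSets.
Context {R : realType} {d : nat}.

Lemma dist_Zspan_le (B : 'M[R]_d) (v : 'cV[R]_d) :
  B \in unitmx ->
  exists z : 'cV[int]_d, `|v - B *m map_mx intr z| <= d%:R * `|B|.
Proof.
move=> uB; pose c := invmx B *m v.
(* The coordinates of [v] in the basis [B] are rounded down, leaving fractional parts of absolute
   value at most 1. *)
exists (\col_i Num.floor (c i 0)).
set z := map_mx _ _.
have -> : v - B *m z = B *m (c - z) by rewrite mulmxBr mulKVmx.
apply: (le_trans (ler_norm_mulmx _ _)); rewrite ler_wpM2l// ler_piMr//.
apply: norm_le_coord => // i j; rewrite !mxE ord1.
rewrite ger0_norm ?subr_ge0 ?floor_le// lerBlDl.
by rewrite (le_trans (ltW (floorD1_gt _)))// intrD.
Qed.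

Lemma ex_large_image (A : 'M[R]_d) :
  exists2 e : 'cV[R]_d, `|e| <= 1 & `|A| <= `|A *m e|.
Proof.
have [->|A0] := eqVneq A 0.
  by exists 0; rewrite ?normr0.
have [|[i j] /= AE] := @mx_norm_neq0 _ _ _ A; first by rewrite -normr_eq0 in A0.
(* The standard basis vector picks the column holding an entry of largest absolute value. *)
exists (delta_mx j 0).
  apply: norm_le_coord => // k l; rewrite mxE.
  by case: (_ && _); rewrite ?normr1 ?normr0.
rewrite [`|A|]AE.
have -> : A i j = (A *m delta_mx j (0 : 'I_1)) i 0 by rewrite -colE mxE.
exact: coord_le_norm.
Qed.

(* Any dense subset of R would do for the second component; countability turns
   the finite subcover below into an initial segment of nat. *)
Definition shift_enum (i : nat) : 'cV[int]_d * rat := odflt (0, 0) (unpickle i).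

Lemma near_finite_hits (F : 'cV[R]_d -> R) (O : set R) (g : SL R d)
    (u : 'cV[R]_d) (C : R) :
  continuous F -> nondegenerate_fun F -> open O -> range F `&` O !=set0 ->
  u != 0 ->
  exists N : nat, \forall Bu \near (val g, u), forall v, `|v| <= C ->
    exists2 i, (i < N)%N & O (F (Bu.1 *m map_mx intr (shift_enum i).1 + v
                                 + ratr (shift_enum i).2 *: Bu.2)).
Proof.
move=> Fc Fnd oO [_ [[p _ <-] Op]] u0.
(* With the bound [N] as a coordinate of the filter, compactness of the ball yields one [N] and one
   neighbourhood of [(g, u)] valid for all [v] at once. *)
pose G := filter_prod \oo (nbhs (val g : 'M[R]_d, u)).
have FG : Filter G by exact: filter_prod_filter.
suff cover : \forall NBu \near G, [set v : 'cV[R]_d | `|v| <= C] `<=` [set v |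
    exists2 i, (i < NBu.1)%N &
      O (F (NBu.2.1 *m map_mx intr (shift_enum i).1 + v
            + ratr (shift_enum i).2 *: NBu.2.2))].
  move: cover => [[/= A1 A2] [[N _ NA1] A2u] A12]; exists N.
  apply: filterS A2u => Bu A2Bu v vC.
  by apply: (A12 (N, Bu)) => //; split => //; apply: NA1; exact: leqnn.
apply: ((compact_near_coveringP _).1 (@compact_closed_ball_cV R d C)).
move=> v _.
have := Fnd <[u]>%VS (translate (lattice_of g) v).
have uV : (<[u]>%VS != 0%VS :> {vspace 'cV[R]_d}).
  apply/eqP => /(congr1 (fun W : {vspace 'cV[R]_d} => u \in W)).
  by rewrite memv_line memv0 (negbTE u0).
move=> /(_ uV)/seteqP[_] /(_ (F p))[]; first by exists p.
move=> _ /vlineP[k ->] [_ [_ [z _ <-] <-] Fpk].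
pose f (s : R) := F (s *: u + (val g *m map_mx intr z + v)).
have fc : continuous f.
  move=> s; apply: continuous_comp; last exact: Fc.
  apply: (cvgD (FF := nbhs_filter s)); last exact: cvg_cst.
  by apply: cvgZr_tmp; exact: cvg_id.
(* Nondegeneracy on the line through [u] gives a real multiple [k]; since the good multiples form an
   open set, a rational one exists. *)
have [k' [Of [r _ rE]]] : f @^-1` O `&` (@ratr R @` setT) !=set0.
  apply: dense_rat; first by exists k; rewrite /f/= Fpk.
  by apply: open_comp.
pose i := pickle (z, r).
have iE : shift_enum i = (z, r) by rewrite /shift_enum pickleK.
have H : (F (NBu.2.2.1 *m map_mx intr z + NBu.1 + ratr r *: NBu.2.2.2)
    @[NBu --> filter_prod (nbhs v) G] -->
    F (val g *m map_mx intr z + v + ratr r *: u)).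
  apply: (continuous_cvg _ (Fc _)).
  apply: cvgD.
    apply: cvgD.
      apply: cvg_mulmx; last exact: cvg_cst.
      apply: (cvg_comp (snd \o snd) fst (G := nbhs (val g : 'M[R]_d, u))).
        exact: (cvg_comp _ _ cvg_snd cvg_snd).
      exact: cvg_fst.
    exact: cvg_fst.
  apply: cvgZl_tmp.
  apply: (cvg_comp (snd \o snd) snd (G := nbhs (val g : 'M[R]_d, u))).
    exact: (cvg_comp _ _ cvg_snd cvg_snd).
  exact: cvg_snd.
have H2 : \forall NBu \near filter_prod (nbhs v) G, (i < NBu.2.1)%N.
  exists (setT, [set NBu | (i < NBu.1)%N]) => /=; last by move=> ? [].
  split; first exact: filterT.
  exists ([set N | (i < N)%N], setT) => /=; last by move=> ? [].
  by split; [exists i.+1|exact: filterT].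
have H1 : \forall NBu \near filter_prod (nbhs v) G,
    O (F (NBu.2.2.1 *m map_mx intr z + NBu.1 + ratr r *: NBu.2.2.2)).
  apply: H; apply: open_nbhs_nbhs; split => //.
  by rewrite addrC rE.
apply: filterS2 H1 H2 => -[v' [N Bu]] /= OF iN.
by exists i; rewrite ?iE.
Qed.

Lemma fiber_gridP (x : lattice R d) (y : fiber x) :
  exists v, fiber_grid y = translate_set x v :> set 'cV[R]_d.
Proof.
have [v vE] := torus_act_subproof 0 y; exists v; rewrite -[RHS]vE.
apply/seteqP; split=> [p yp|_ [p yp <-]]; last by rewrite addr0.
by exists p; rewrite ?addr0.
Qed.

Lemma nondivergent_orbit_recurrence (F : 'cV[R]_d -> R) (x : lattice R d) :
  continuous F -> ~ divergent_orbit F x ->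
  exists (A : nat -> SL R d) (e : nat -> 'cV[R]_d) (g : SL R d) (u : 'cV[R]_d),
  [/\ (forall n v, F (val (A n) *m v) = F v),
      (fun n => act (A n) x) @ \oo --> lattice_of g,
      e @ \oo --> (0 : 'cV[R]_d),
      (fun n => val (A n) *m e n) @ \oo --> u & u != 0].
Proof.
move=> Fc /existsNP[h /not_implyP[hdiv /contrapT[phi [l [phii hl]]]]].
have hF n v : F (val (val (h n)) *m v) = F v.
  have /(_ v) := connected_component_sub (set_valP (h n)).
  exact.
pose M n : 'M[R]_d := val (val (h (phi n))).
have Moo c : \forall n \near \oo, c < `|M n|.
  exact: (homo_ltn_cvgy phii (divergent_invariance_group_norm c Fc hdiv)).
have ex_e n : exists e : 'cV[R]_d, `|e| <= 1 /\ `|M n| <= `|M n *m e|.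
  by have [e e1 Me] := ex_large_image (M n); exists e.
have [e eP] := choice ex_e.
(* Normalized so that [M n *m f n] has norm 1 once [M n] is nonzero: its limit points have norm 1,
   while [f n] has norm at most the inverse of that of [M n] and tends to 0. *)
pose f n := `|M n *m e n|^-1 *: e n.
have Mf n : 0 < `|M n| -> `|M n *m f n| = 1.
  move=> M0; rewrite -scalemxAr normrZ normfV normr_id mulVf// gt_eqF//.
  by rewrite (lt_le_trans M0)//; have [] := eP n.
have [|psi [u [psii Mu]]] :=
    @bounded_mx_cvg_subsequence _ _ _ (fun n => M n *m f n) 1.
  move=> n; rewrite -scalemxAr normrZ normfV normr_id.
  have [->|M0] := eqVneq `|M n *m e n| 0; first by rewrite mulr0.
  by rewrite mulVf.
exists (fun n => val (h (phi (psi n)))), (f \o psi), (lattice_repr l), u.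
have psioo := homo_ltn_cvgy psii.
split.
- by move=> n v; exact: hF.
- rewrite lattice_reprK.
  exact: (cvg_comp _ _ psioo hl).
- suff f0 : f @ \oo --> (0 : 'cV[R]_d) by exact: (cvg_comp _ _ psioo f0).
  apply/cvgr0Pnorm_lt => eps eps0.
  near=> n.
  have Mn : eps^-1 < `|M n| by near: n; exact: Moo.
  have [e1 Me] := eP n.
  have Me0 : 0 < `|M n *m e n|.
    by rewrite (lt_le_trans _ Me)// (lt_trans _ Mn)// invr_gt0.
  rewrite normrZ normfV normr_id -ltr_pdivlMl ?invr_gt0// invrK.
  rewrite (le_lt_trans e1)// -ltr_pdivrMr// mul1r (lt_le_trans Mn)//.
- exact: Mu.
- apply/eqP => u0.
  have N1 : `|M (psi n) *m f (psi n)| @[n --> \oo] --> (1 : R).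
    apply: cvg_near_cst.
    have : \forall n \near \oo, 0 < `|M (psi n)| by exact: (psioo _ (Moo 0)).
    by apply: filterS => n; exact: Mf.
  have N0 : `|M (psi n) *m f (psi n)| @[n --> \oo] --> `|u|.
    exact: cvg_norm Mu.
  rewrite u0 normr0 in N0.
  suff : (1 : R) == 0 by rewrite oner_eq0.
  by apply/eqP/(cvg_unique (@Rhausdorff R) N1 N0).
Unshelve. all: by end_near. Qed.

Lemma null_fiber_avoiding (F : 'cV[R]_d -> R) (x : lattice R d)
    (lambda : probability (borel_fiber x) R) (O : set R) :
  continuous F -> nondegenerate_fun F -> ~ divergent_orbit F x ->
  is_haar lambda -> open O -> range F `&` O !=set0 ->
  lambda (fiber_avoiding x (F @^-1` O)) = 0%E.
Proof.
move=> Fc Fnd xnd haar oO FO.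
have [A [e [g [u [FA Axg e0 Aeu u0]]]]] := nondivergent_orbit_recurrence Fc xnd.
have [N nearN] :=
  (* The radius bounds the distance from any vector to [B Z^d] for every invertible [B] of norm at
     most [|g| + 1], by [dist_Zspan_le]. *)
  near_finite_hits g (d%:R * (`|val g : 'M[R]_d| + 1)) Fc Fnd oO FO u0.
have oFO : open (F @^-1` O) by apply: open_comp => // v _; exact: Fc.
pose E : set (borel_fiber x) := fiber_avoiding x (F @^-1` O).
pose w i n := ratr (shift_enum i).2 *: e n.
have mE : measurable E by exact: measurable_fiber_avoiding.
pose D i n : set (borel_fiber x) := E `\` torus_act (w i n) @^-1` E.
have mD i n : measurable (D i n).
  apply: measurableD => //.
  rewrite /E torus_act_fiber_avoiding; apply: measurable_fiber_avoiding.
  exact: open_translate.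
have D0 i : lambda (D i n) @[n --> \oo] --> 0%E.
  apply: haar_shift_cvg => //.
  have w0 : w i @ \oo --> (ratr (shift_enum i).2 : R) *: (0 : 'cV[R]_d).
    exact: cvgZl_tmp.
  by rewrite scaler0 in w0.
have S0 : (\sum_(i < N) lambda (D i n))%E @[n --> \oo] --> 0%E.
  have := @cvg_nnesum _ \oo _ R 'I_N (index_enum 'I_N)
    (fun i n => lambda (D i n)) (fun=> 0%E) xpredT.
  rewrite big1//; apply=> // i _.
  by apply: nearW => n; exact: measure_ge0.
apply/eqP; rewrite eq_le measure_ge0 andbT.
(* It now suffices that, for large [n], the [N] sets [D i n] cover [E]. *)
apply: (cvge_to_ge S0).
have nearB : \forall Bu \near (val g : 'M[R]_d, u),
   [/\ Bu.1 \in unitmx, `|Bu.1| <= `|val g : 'M[R]_d| + 1 & 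
   forall v, `|v| <= d%:R * (`|val g : 'M[R]_d| + 1) ->
    exists2 i, (i < N)%N & O (F (Bu.1 *m map_mx intr (shift_enum i).1 + v
                                 + ratr (shift_enum i).2 *: Bu.2))].
  have toB : fst Bu @[Bu --> nbhs (val g : 'M[R]_d, u)] --> (val g : 'M[R]_d).
    exact: cvg_fst.
  have detB : \forall Bu \near (val g : 'M[R]_d, u), \det Bu.1 != 0.
    apply: (toB [set B : 'M[R]_d | \det B != 0]).
    apply: (@det_continuous _ _ (val g) [set c : R | c != 0]).
    apply: open_nbhs_nbhs; split; first exact: open_neq.
    by rewrite /= (set_valP g) oner_neq0.
  have normB : \forall Bu \near (val g : 'M[R]_d, u),
      `|Bu.1| <= `|val g : 'M[R]_d| + 1.
    apply: (toB [set B : 'M[R]_d | `|B| <= `|val g : 'M[R]_d| + 1]).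
    apply: (@norm_continuous _ _ (val g : 'M[R]_d) [set c : R | c <= _ + 1]).
    by apply: lt_le_nbhsl; rewrite ltrDl.
  apply: filterS3 detB normB nearN => Bu dB nB hit; split => //.
  by rewrite unitmxE unitfE.
have [[V U] /= [gV uU] VU] := nearB.
have nearU : \forall n \near \oo, U (val (A n) *m e n) by exact: Aeu.
apply: filterS2 (near_lattice_basis Axg gV) nearU => n [B VB Bx] Un.
have [/= uB Bg hit] := VU (B, val (A n) *m e n) (conj VB Un).
apply: le_trans (Boole_inequality lambda (fun i _ => mD i n)).
apply: le_measure; rewrite ?inE//.
  by apply: bigsetU_measurable => i _.
move=> y Ey.
have [v yE] := fiber_gridP y.
(* A point of [B Z^d] is subtracted to bring [A_n v] into the ball where [hit] applies. *)
have [z0 z0P] := dist_Zspan_le (val (A n) *m v) uB.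
have [|i iN OF] := hit (val (A n) *m v - B *m map_mx intr z0).
  by rewrite (le_trans z0P)// ler_wpM2l.
rewrite -(bigcup_mkord N (fun i => D i n)); exists i => //; split => //.
rewrite /E torus_act_fiber_avoiding.
(* Here [q] lies in [x] and [A_n q = B (z_i - z0)], so [A_n (q + v + t e_n) = B z_i + (A_n v - B z0)
   + t A_n e_n], the point supplied by [hit]. *)
have [q xq qE] := Bx ((shift_enum i).1 - z0).
move=> /(_ (q + v)); apply.
  by rewrite yE; exists q.
rewrite /= -(FA n) /w; move: OF.
congr (O (F _)); rewrite !mulmxDr qE -scalemxAr map_mxB mulmxBr.
by rewrite addrA addrAC.
Qed.

End NullSets.

Theorem theorem2p1 (R : realType) (d : nat) (d_gt0 : (0 < d)%N)
    (F : 'cV[R]_d -> R) (F_cont : continuous F)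
    (F_nondeg : nondegenerate_fun F) (F_noncompact : noncompact_fun F)
    (x : lattice R d) (x_nondiv : ~ divergent_orbit F x)
    (lambda : probability (borel_fiber x) R) (lambda_haar : is_haar lambda) :
  almost_surely_grid_DV F lambda.
Proof.
(* Density is tested on countably many rational intervals. The default pair gives the empty
   interval, and [E k] is empty whenever [I k] misses the range of [F]. *)
pose I k : set R := let ab := odflt (0, 0) (unpickle k : option (rat * rat)) in
  `]ratr ab.1, ratr ab.2[%classic.
have oI k : open (I k) by exact: interval_open.
pose E k := [set y : borel_fiber x | range F `&` I k !=set0 /\
  fiber_avoiding x (F @^-1` I k) y].
have E0 k : lambda.-negligible (E k).
  have [FI|FI] := pselect (range F `&` I k !=set0).
    exists (fiber_avoiding x (F @^-1` I k)); split; last by move=> y [].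
      apply: measurable_fiber_avoiding.
      by apply: open_comp => [v _|]; [exact: F_cont|exact: oI].
    exact: null_fiber_avoiding.
  by apply: negligibleS (negligible_set0 lambda) => y [/FI].
apply: (negligibleS _ (negligible_bigcup E0)) => y.
move=> /existsNP[t /not_implyP[Ft /existsNP[B /not_implyP[+ Bt]]]].
(* A grid that is not DV misses a ball around some [t] in the range; a rational interval around [t]
   inside this ball places the grid in some [E k]. *)
move=> /nbhs_ballP[eps /= eps0 tB].
have ta' : t - eps < t by rewrite ltrBlDr ltrDl.
have [a] := rat_in_itvoo ta'.
have tb' : t < t + eps by rewrite ltrDl.
have [b] := rat_in_itvoo tb'.
rewrite !in_itv/= => /andP[tb bt] /andP[ta at'].
have IE : I (pickle (a, b)) = `]ratr a, ratr b[%classic by rewrite /I pickleK.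
exists (pickle (a, b)) => //; split.
  by exists t; split => //; rewrite IE /= in_itv/= at'.
move=> p yp; rewrite /= IE /= in_itv /= => /andP[aFp Fpb]; apply: Bt.
exists (F p); split; first by exists p.
apply: tB; rewrite /ball/= ltr_distlC.
by rewrite (lt_trans ta)// (lt_trans Fpb).
Qed.
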